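(* Let $\mathcal{F}$ be a symmetric control family of Lipschitz continuous vector fields on $\mathbb{R}^d$ (symmetric meaning that $f\in\mathcal{F}$ implies $-f\in\mathcal{F}$). If $\mathcal{H}(\mathcal{F})$ has the $C$-UAP for $\mathrm{Diff}_0(\mathbb{R}^d)$ and has the local UIP, then $\mathcal{F}$ achieves the UIP, i.e. $\mathcal{H}(\mathcal{F})$ has the UIP.
   Context: For a Lipschitz vector field $v:\mathbb{R}^d\to\mathbb{R}^d$ and $\tau\ge 0$, the flow map $\phi_v^\tau$ sends $x_0$ to $x(\tau)$, where $\dot x(t)=v(x(t))$, $x(0)=x_0$. A control family $\mathcal{F}$ is a set of such vector fields, and $$\mathcal{H}(\mathcal{F})=\{\phi_{f_n}^{\tau_n}\circ\cdots\circ\phi_{f_1}^{\tau_1} : f_i\in\mathcal{F},\ \tau_i\ge 0,\ n\in\mathbb{N}\}.$$ $\mathrm{Diff}_0(\mathbb{R}^d)$ is the set of orientation-preserving diffeomorphisms of $\mathbb{R}^d$. $C$-UAP for $\mathrm{Diff}_0(\mathbb{R}^d)$: for every compact $\Omega\subset\mathbb{R}^d$, every $g\in\mathrm{Diff}_0(\mathbb{R}^d)$ and every $\varepsilon>0$ there is $h\in\mathcal{H}(\mathcal{F})$ with $\|g(x)-h(x)\|\le\varepsilon$ for all $x\in\Omega$. UIP: a set $\mathcal{H}$ of maps $\mathbb{R}^d\to\mathbb{R}^d$ has the UIP if for every positive integer $N$ and all data $(x_1,y_1),\dots,(x_N,y_N)\in\mathbb{R}^d\times\mathbb{R}^d$ with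 $x_i\neq x_j$ and $y_i\ne y_j$ for all $i\ne j$, there exists $\varphi\in\mathcal{H}$ with $\varphi(x_i)=y_i$ for $i=1,\dots,N$. Local UIP: $\mathcal{H}$ has the local UIP if for every positive integer $N$ there exist $N$ distinct points $x_1,\dots,x_N\in\mathbb{R}^d$ and $\delta>0$ such that for any $N$ distinct points $y_1,\dots,y_N\in\mathbb{R}^d$ with $\|y_i-x_i\|<\delta$ for all $i$, there exists $\varphi\in\mathcal{H}$ with $\varphi(x_i)=y_i$ for $i=1,\dots,N$. Convention when $d=1$: in both UIP and local UIP only data with $x_1<\cdots<x_N$ and $y_1<\cdots<y_N$ are considered. *)

(* Defs.v *)
From HB Require Import structures.
From mathcomp Require Import all_boot all_order all_algebra.
From mathcomp Require Import all_classical all_reals all_analysis.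
Import Order.TTheory GRing.Theory Num.Theory.
Import numFieldNormedType.Exports.

Set Implicit Arguments.
Unset Strict Implicit.
Unset Printing Implicit Defensive.

Local Open Scope classical_set_scope.
Local Open Scope ring_scope.

Definition symmetric_family (R : realType) (d : nat)
    (F : set ('rV[R]_d -> 'rV[R]_d)) : Prop :=
  forall f, F f -> F (\- f).

(* [is_flow v tau phi] says that phi is the time-tau flow map of v. For a
   Lipschitz v the integral curve from x0 is unique and defined on all of R
   (Picard-Lindeloef), so the relation determines exactly one map phi. *)
Definition is_flow (R : realType) (d : nat) (v : 'rV[R]_d -> 'rV[R]_d)
    (tau : R) (phi : 'rV[R]_d -> 'rV[R]_d) : Prop :=
  forall x0 : 'rV[R]_d, exists x : R -> 'rV[R]_d,
    [/\ x 0 = x0, (forall t : R, is_derive t 1 x (v (x t))) & phi x0 = x tau].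

(* The empty composition (n = 0) is the identity; when F is nonempty it is
   also a flow map at time 0. *)
Inductive flow_compositions (R : realType) (d : nat)
    (F : set ('rV[R]_d -> 'rV[R]_d)) : set ('rV[R]_d -> 'rV[R]_d) :=
| flow_comp_id : flow_compositions F id
| flow_comp_step (f : 'rV[R]_d -> 'rV[R]_d) (tau : R)
    (phi h : 'rV[R]_d -> 'rV[R]_d) :
    F f -> 0 <= tau -> is_flow f tau phi -> flow_compositions F h ->
    flow_compositions F (phi \o h).

(* Class C^k. On the finite-dimensional space R^d, f is C^(k+1) iff it is
   differentiable and all its directional derivatives are C^k. *)
Fixpoint class_C (R : realType) (d : nat) (k : nat)
    (f : 'rV[R]_d -> 'rV[R]_d) : Prop :=
  if k is k'.+1 then
    (forall x, differentiable f x) /\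
    (forall v : 'rV[R]_d, class_C k' (fun x => 'D_v f x))
  else continuous f.

Definition smooth (R : realType) (d : nat) (f : 'rV[R]_d -> 'rV[R]_d) : Prop :=
  forall k : nat, class_C k f.

Definition diffeomorphism (R : realType) (d : nat)
    (g : 'rV[R]_d -> 'rV[R]_d) : Prop :=
  smooth g /\ exists g' : 'rV[R]_d -> 'rV[R]_d,
    [/\ smooth g', cancel g g' & cancel g' g].

Definition Diff0 (R : realType) (d : nat) : set ('rV[R]_d -> 'rV[R]_d) :=
  [set g | diffeomorphism g /\ forall x, 0 < \det (jacobian g x)].
Arguments Diff0 : clear implicits.

(* The norm on 'rV[R]_d is the sup norm; all norms on R^d being equivalent,
   this does not affect C_UAP or local_UIP. *)
Definition C_UAP (R : realType) (d : nat)
    (H G : set ('rV[R]_d -> 'rV[R]_d)) : Prop :=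
  forall (Omega : set 'rV[R]_d) (g : 'rV[R]_d -> 'rV[R]_d) (eps : R),
    compact Omega -> G g -> 0 < eps ->
    exists2 h, H h & forall x, Omega x -> `|g x - h x| <= eps.

(* In dimension 1 only increasing data are considered; k then ranges over the
   unique coordinate. *)
Definition admissible (R : realType) (d N : nat) (x : 'I_N -> 'rV[R]_d) : Prop :=
  injective x /\
  (d = 1%N -> forall (i j : 'I_N) (k : 'I_d),
    (i < j)%N -> x i ord0 k < x j ord0 k).

Definition UIP (R : realType) (d : nat)
    (H : set ('rV[R]_d -> 'rV[R]_d)) : Prop :=
  forall (N : nat) (x y : 'I_N -> 'rV[R]_d),
    (0 < N)%N -> admissible x -> admissible y ->
    exists2 phi, H phi & forall i, phi (x i) = y i.

Definition local_UIP (R : realType) (d : nat)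
    (H : set ('rV[R]_d -> 'rV[R]_d)) : Prop :=
  forall N : nat, (0 < N)%N ->
    exists (x : 'I_N -> 'rV[R]_d) (delta : R),
      [/\ admissible x, 0 < delta &
        forall y : 'I_N -> 'rV[R]_d,
          admissible y -> (forall i, `|y i - x i| < delta) ->
          exists2 phi, H phi & forall i, phi (x i) = y i].

(* Main.v *)
Require Import Defs.
From HB Require Import structures.
From mathcomp Require Import all_boot all_order all_algebra.
From mathcomp Require Import all_classical all_reals all_analysis.
From mathcomp Require Import ring lra.
Import Order.TTheory GRing.Theory Num.Theory.
Import numFieldNormedType.Exports.
Local Open Scope classical_set_scope.
Local Open Scope ring_scope.
Set Implicit Arguments.
Unset Strict Implicit.

(** Let [z] be the base points given by the local UIP.  If members [h1], [h2] of
    the family H of flow compositions bring the inputs [x] and the targets [y]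
    close enough to [z], the local UIP provides [psi1], [psi2] in H that send [z]
    exactly to [h1 x] and [h2 y].  H contains inverses, because the flow of [- f]
    runs the curves of [f] backwards, so [h2^-1 o psi2 o psi1^-1 o h1] lies in H
    and sends [x] exactly to [y] ([UIP_of_approximable_transitivity]).  Inverses
    are needed on finite sets only, and there the reversed curves can be selected
    by hand ([flow_left_inverse_on]).

    It remains to bring an arbitrary configuration close to [z].  Call a
    continuous map approximable when H approximates it on finite configurations.
    Approximable maps form a monoid ([approximable_comp]), closed under pointwise
    limits with continuous limit ([approximable_closed]), and by the C-UAP this
    monoid contains Diff0.  So it suffices to find explicit elements of Diff0, of
    which finite products, or limits of these, act transitively on
    configurations.

    - In dimension at least 2, shears along the level sets of a linear form [l]
      move points freely inside these level sets, provided that [l] separates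
      the points ([shear_interpolation], by Lagrange interpolation).  Three shears,
      alternating between a generic form and a coordinate, carry any
      configuration of distinct points to any other ([Diff0_transitive]).

    - In dimension 1, increasing piecewise linear maps interpolate increasing
      data.  They are products of translations and of maps with a single kink, and a
      kink is the limit of smooth branches of hyperbolas with the same two
      asymptotes; such a branch has an inverse of the same kind, hence lies in
      Diff0 ([kink_approximable], [approximable_transitive_line]). *)

(** * Flow compositions form a monoid with inverses *)

Lemma flow_compositions_comp (R : realType) (d : nat)
    (F : set ('rV[R]_d -> 'rV[R]_d)) (g h : 'rV[R]_d -> 'rV[R]_d) :
  flow_compositions F g -> flow_compositions F h ->
  flow_compositions F (g \o h).
Proof.
move=> Fg Fh; elim: Fg => [//|f tau phi g' Ff tau_ge0 flow_phi _ IH].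
exact: (@flow_comp_step R d F f tau phi (g' \o h)).
Qed.

Lemma is_derive_reversed (R : realType) (d : nat) (v : 'rV[R]_d -> 'rV[R]_d)
    (c : R -> 'rV[R]_d) (a : R) :
  (forall t : R, is_derive t 1 c (v (c t))) ->
  forall t : R, is_derive t 1 (fun s => c (a - s)) ((\- v) (c (a - t))).
Proof.
move=> dc t; have [c1 c2] := dc (a - t).
have rev1 : is_derive t 1 (fun s : R => a - s) (- 1).
  by rewrite -[- 1]add0r; apply: is_deriveB.
have [/derivable1_diffP dr dr1] := rev1.
move/derivable1_diffP in c1.
apply: (@DeriveDef _ _ _ _ _ (c \o (fun s : R => a - s))).
  by apply/derivable1_diffP; exact: differentiable_comp.
rewrite deriveE; last exact: differentiable_comp.
rewrite deriveE// in dr1; rewrite deriveE// in c2.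
by rewrite diff_comp//= dr1 linearN c2.
Qed.

(** On [phi @` A] the inverse retraces, backwards, the very curve that led from
    [x] to [phi x]; injectivity of [phi] on [A] makes this choice of curve
    unambiguous.  At other points any reversed integral curve will do, since
    [is_flow] only asks for the existence of some curve from each point. *)
Lemma flow_left_inverse_on (R : realType) (d : nat) (v : 'rV[R]_d -> 'rV[R]_d)
    (tau : R) (phi : 'rV[R]_d -> 'rV[R]_d) (A : set 'rV[R]_d) :
  is_flow v tau phi -> {in A &, injective phi} ->
  exists2 psi, is_flow (\- v) tau psi & forall x, A x -> psi (phi x) = x.
Proof.
move=> flow_phi phi_inj.
pose curve_end (w u : 'rV[R]_d) := exists c : R -> 'rV[R]_d,
  [/\ c 0 = w, (forall t : R, is_derive t 1 c ((\- v) (c t))) & u = c tau].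
have /choice[psi psiP] : forall w, exists u,
    curve_end w u /\ forall x, A x -> phi x = w -> u = x.
  move=> w; have [[x [Ax phix]]|noA] := pselect (exists x, A x /\ phi x = w).
    exists x; split; last first.
      by move=> y Ay phiy; apply: phi_inj; rewrite ?inE// phix.
    have [c [c0 dc cE]] := flow_phi x.
    exists (fun s => c (tau - s)); split; last by rewrite subrr.
      by rewrite subr0 -cE.
    exact: is_derive_reversed.
  have [c [c0 dc _]] := flow_phi w.
  exists (c (0 - tau)); split; last by move=> x Ax phix; case: noA; exists x.
  exists (fun s => c (0 - s)); split=> //; first by rewrite subrr.
  exact: is_derive_reversed.
exists psi => [w|x Ax]; first by have [] := psiP w.
by have [_ /(_ x Ax erefl)] := psiP (phi x).
Qed.

(** Undo the flows in reverse order: if the whole composition is injective on [A],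
    each factor is injective on the image of [A] on which it acts. *)
Lemma flow_compositions_left_inverse_on (R : realType) (d : nat)
    (F : set ('rV[R]_d -> 'rV[R]_d)) (h : 'rV[R]_d -> 'rV[R]_d) :
  symmetric_family F -> flow_compositions F h ->
  forall A : set 'rV[R]_d, {in A &, injective h} ->
  exists2 k, flow_compositions F k & forall x, A x -> k (h x) = x.
Proof.
move=> F_sym; elim=> [|f tau phi g Ff tau_ge0 flow_phi _ IH] A h_inj.
  by exists id => //; exact: flow_comp_id.
have g_inj : {in A &, injective g}.
  by move=> x y Ax Ay gxy; apply: h_inj => //=; rewrite gxy.
have phi_inj : {in g @` A &, injective phi}.
  move=> _ _ /set_mem[x Ax <-] /set_mem[y Ay <-] phixy.
  by congr g; apply: h_inj; rewrite ?inE.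
have [k Fk kK] := IH A g_inj.
have [psi flow_psi psiK] := flow_left_inverse_on flow_phi phi_inj.
exists (k \o psi) => [|x Ax]; last by rewrite /= psiK ?kK//; exists x.
apply: flow_compositions_comp => //.
apply: (@flow_comp_step _ _ _ (\- f) tau psi id) => //; first exact: F_sym.
exact: flow_comp_id.
Qed.

(** * Maps approximated on finite configurations *)

(** Continuity is part of the definition because approximations are composed:
    the outer map is applied to points that are only approximately right. *)
Definition approximable (R : realType) (d : nat) (H : set ('rV[R]_d -> 'rV[R]_d))
    (T : 'rV[R]_d -> 'rV[R]_d) : Prop :=
  continuous T /\
  forall (N : nat) (x : 'I_N -> 'rV[R]_d) (eps : R), 0 < eps ->
    exists2 h, H h & forall i, `|T (x i) - h (x i)| <= eps.

Lemma common_radius (R : realType) (I : finType) (P : I -> R -> Prop) :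
  (forall i, exists2 e, 0 < e & P i e) ->
  (forall i e e', P i e -> 0 < e' -> e' <= e -> P i e') ->
  exists2 e, 0 < e & forall i, P i e.
Proof.
move=> Pe Pmono.
have /choice[r rP] : forall i, exists e, 0 < e /\ P i e.
  by move=> i; have [e e_gt0 Pie] := Pe i; exists e.
have e_gt0 : 0 < \big[Num.min/1]_i r i.
  by elim/big_ind: _ => [//|a b a_gt0 b_gt0|i _]; [rewrite lt_min a_gt0|have [] := rP i].
exists (\big[Num.min/1]_i r i) => // i.
by have [_ /Pmono] := rP i; apply => //; rewrite bigmin_le.
Qed.

Lemma continuous_finite_modulus (R : realType) (d N : nat)
    (T : 'rV[R]_d -> 'rV[R]_d) (x : 'I_N -> 'rV[R]_d) (eps : R) :
  continuous T -> 0 < eps ->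
  exists2 del, 0 < del &
    forall i y, `|x i - y| <= del -> `|T (x i) - T y| <= eps.
Proof.
move=> cT eps_gt0.
apply: (@common_radius R 'I_N
  (fun i e => forall y, `|x i - y| <= e -> `|T (x i) - T y| <= eps)).
  move=> i; have /cvgrPdist_le /(_ _ eps_gt0) := cT (x i).
  move=> /nbhs_ballP[e /= e_gt0 be]; exists (e / 2) => [|y xy]; first by rewrite divr_gt0.
  by apply: be; rewrite -ball_normE /=; apply: le_lt_trans xy _; lra.
by move=> i e e' Pe e'_gt0 e'e y xy; apply: Pe; exact: le_trans xy e'e.
Qed.

(** First approximate [T] on the given points, within a modulus of continuity of
    [S] at their images, then [S] at the points actually reached. *)
Lemma approximable_comp (R : realType) (d : nat) (H : set ('rV[R]_d -> 'rV[R]_d))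
    (S T : 'rV[R]_d -> 'rV[R]_d) :
  (forall g h, H g -> H h -> H (g \o h)) ->
  approximable H S -> approximable H T -> approximable H (S \o T).
Proof.
move=> H_comp [cS aS] [cT aT]; split=> [x|N x eps eps_gt0].
  by apply: continuous_comp; [exact: cT|exact: cS].
have eps2_gt0 : 0 < eps / 2 by rewrite divr_gt0.
have [del del_gt0 delP] := continuous_finite_modulus (T \o x) cS eps2_gt0.
have [h Hh hP] := aT N x del del_gt0.
have [g Hg gP] := aS N (h \o x) _ eps2_gt0.
exists (g \o h) => [|i]; first exact: H_comp.
rewrite /= -(subrKA (S (h (x i)))) (splitr eps).
apply: le_trans (ler_normD _ _) _; apply: lerD; last exact: gP.
exact: delP (hP i).
Qed.

(** This lets piecewise linear maps be used along with diffeomorphisms. *)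
Lemma approximable_closed (R : realType) (d : nat) (H : set ('rV[R]_d -> 'rV[R]_d))
    (T : 'rV[R]_d -> 'rV[R]_d) :
  continuous T ->
  (forall (N : nat) (x : 'I_N -> 'rV[R]_d) (eps : R), 0 < eps ->
    exists2 S, approximable H S & forall i, `|T (x i) - S (x i)| <= eps) ->
  approximable H T.
Proof.
move=> cT aT; split=> // N x eps eps_gt0.
have eps2_gt0 : 0 < eps / 2 by rewrite divr_gt0.
have [S [_ aS] TS] := aT N x _ eps2_gt0.
have [h Hh Sh] := aS N x _ eps2_gt0.
exists h => // i; rewrite -(subrKA (S (x i))) (splitr eps).
by apply: le_trans (ler_normD _ _) _; rewrite lerD.
Qed.

Lemma approximable_Diff0 (R : realType) (d : nat) (H : set ('rV[R]_d -> 'rV[R]_d))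
    (g : 'rV[R]_d -> 'rV[R]_d) :
  C_UAP H (Diff0 R d) -> Diff0 R d g -> approximable H g.
Proof.
move=> UAP dg; split=> [|N x eps eps_gt0]; first by have [[/(_ 0%N)]] := dg.
have x_compact : compact (range x).
  by apply: finite_compact; apply: finite_image; exact: finite_finset.
have [h Hh hP] := UAP _ g eps x_compact dg eps_gt0.
by exists h => // i; apply: hP; exists i.
Qed.

(** * From approximate transitivity to interpolation *)

Lemma rV1_norm (R : realType) (u : 'rV[R]_1) : `|u| = `|u ord0 ord0|.
Proof.
rewrite [LHS]mx_normrE; apply/le_anti/andP; split.
  by apply: bigmax_le => // -[i j] _; rewrite !ord1.
exact: (le_bigmax _ (fun ij => `|u ij.1 ij.2|) (ord0, ord0)).
Qed.

Lemma admissible_open (R : realType) (d N : nat) (z : 'I_N -> 'rV[R]_d) :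
  admissible z ->
  exists2 eta, 0 < eta & forall y, (forall i, `|z i - y i| <= eta) -> admissible y.
Proof.
move=> [z_inj z_incr].
(* At most a third of the least gap: two errors of [eta] leave a gap of at least [eta]. *)
have [eta eta_gt0 etaP] : exists2 eta, 0 < eta &
    forall p : 'I_N * 'I_N, p.1 != p.2 -> eta * 3 <= `|z p.1 - z p.2|.
  apply: (@common_radius R ('I_N * 'I_N)%type
    (fun p e => p.1 != p.2 -> e * 3 <= `|z p.1 - z p.2|)).
    move=> [i j] /=; have [->|ij] := eqVneq i j; first by exists 1.
    have zij : 0 < `|z i - z j| by rewrite normr_gt0 subr_eq0 (inj_eq z_inj).
    by exists (`|z i - z j| / 3) => [|_]; [rewrite divr_gt0|rewrite divfK].
  by move=> p e e' Pe _ e'e /Pe; apply: le_trans; rewrite ler_pM2r.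
exists eta => // y zy; split=> [i j yij|d1 i j k ij].
  apply/eqP/negPn/negP => ij; have := etaP (i, j) ij => /=; apply/negP; rewrite -ltNge.
  rewrite -(subrKA (y i)) {2}yij.
  apply: le_lt_trans (ler_normD _ _) _; rewrite [X in _ + X]distrC.
  by apply: le_lt_trans (lerD (zy i) (zy j)) _; lra.
have := etaP (i, j); rewrite /= -val_eqE /= ltn_eqF// => /(_ isT) zij.
subst d; rewrite (ord1 k); have {}ij := z_incr erefl i j ord0 ij.
have := zy i; have := zy j.
move: zij; rewrite !rV1_norm !mxE [X in _ <= X]ler0_norm; last by rewrite subr_le0 ltW.
rewrite !ler_norml => zij /andP[_ zyj] /andP[zyi _].
have -> : (0 : 'I_1) = ord0 by apply/ord_inj.
lra.
Qed.

(** Approximation may be rough, since the local UIP corrects the error: both the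
    inputs and the targets are brought near the base points [z], and the two
    configurations so obtained are exactly reachable from [z]. *)
Lemma UIP_of_approximable_transitivity (R : realType) (d : nat)
    (F : set ('rV[R]_d -> 'rV[R]_d)) :
  symmetric_family F -> local_UIP (flow_compositions F) ->
  (forall (N : nat) (x z : 'I_N -> 'rV[R]_d), admissible x -> admissible z ->
    exists2 T, approximable (flow_compositions F) T & forall i, T (x i) = z i) ->
  UIP (flow_compositions F).
Proof.
move=> F_sym F_loc trans N x y N_gt0 x_adm y_adm.
have [z [del [z_adm del_gt0 z_loc]]] := F_loc N N_gt0.
have [eta eta_gt0 z_open] := admissible_open z_adm.
have reach u : admissible u -> exists h psi : 'rV[R]_d -> 'rV[R]_d,
    [/\ flow_compositions F h, flow_compositions F psi,
        forall i, psi (z i) = h (u i) & injective (h \o u)].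
  move=> u_adm; have [T [_ aT] Tu] := trans N u z u_adm z_adm.
  pose eps := Num.min eta (del / 2).
  have eps_gt0 : 0 < eps by rewrite lt_min eta_gt0 divr_gt0.
  have [h Fh hP] := aT N u _ eps_gt0.
  have hu_adm : admissible (h \o u).
    apply: z_open => i; rewrite -Tu; apply: le_trans (hP i) _.
    by rewrite ge_min lexx.
  have [|psi Fpsi psiP] := z_loc _ hu_adm.
    move=> i; rewrite distrC -Tu; apply: le_lt_trans (hP i) _.
    by rewrite gt_min; apply/orP; right; lra.
  by exists h, psi; split=> //; have [] := hu_adm.
have [h1 [psi1 [Fh1 Fpsi1 psi1P h1_inj]]] := reach x x_adm.
have [h2 [psi2 [Fh2 Fpsi2 psi2P h2_inj]]] := reach y y_adm.
have [|psi1' Fpsi1' psi1'K] :=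
    flow_compositions_left_inverse_on F_sym Fpsi1 (A := range z).
  move=> _ _ /set_mem[i _ <-] /set_mem[j _ <-]; rewrite !psi1P => hij.
  by congr z; exact: h1_inj.
have [|h2' Fh2' h2'K] := flow_compositions_left_inverse_on F_sym Fh2 (A := range y).
  move=> _ _ /set_mem[i _ <-] /set_mem[j _ <-] hij.
  by congr y; exact: h2_inj.
exists (h2' \o (psi2 \o (psi1' \o h1))) => [|i].
  by do 3!apply: flow_compositions_comp => //.
rewrite /= -psi1P psi1'K; last by exists i.
by rewrite psi2P h2'K//; exists i.
Qed.

(** * Smoothness of ridge maps *)

(** Polynomials in [t], [sqrt (t ^+ 2 + e)] and its inverse.  This class contains
    the profiles of shears and the branches of hyperbolas, and it is stable under
    differentiation, so that its members are smooth without any computation of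
    higher derivatives. *)
Inductive elem_fun (R : realType) (e : R) : set (R -> R) :=
| elem_cst a : elem_fun e (cst a)
| elem_id : elem_fun e id
| elem_sqrt : elem_fun e (fun t => Num.sqrt (t ^+ 2 + e))
| elem_sqrtV : elem_fun e (fun t => (Num.sqrt (t ^+ 2 + e))^-1)
| elem_add F G : elem_fun e F -> elem_fun e G -> elem_fun e (F \+ G)
| elem_mul F G : elem_fun e F -> elem_fun e G -> elem_fun e (F \* G).

Lemma sqr_add_gt0 (R : realType) (e t : R) : 0 < e -> 0 < t ^+ 2 + e.
Proof. by move=> e_gt0; rewrite ltr_wpDl ?sqr_ge0. Qed.

Lemma is_derive_sqrt_sqr_add (R : realType) (e t : R) : 0 < e ->
  is_derive t 1 (fun u => Num.sqrt (u ^+ 2 + e)) (t * (Num.sqrt (t ^+ 2 + e))^-1).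
Proof.
move=> e_gt0; have q_gt0 := sqr_add_gt0 t e_gt0.
have dq : is_derive t 1 (fun u : R => u ^+ 2 + e) (2 * t).
  rewrite (_ : (fun u => _) = horner ('X ^+ 2 + e%:P)); last first.
    by apply/funext => u; rewrite !hornerE.
  apply: is_derive_eq.
  by rewrite derivD derivXn derivC addr0 hornerMn hornerXn expr1 -mulr_natl.
apply: is_derive_eq; first
  exact: (@is_derive1_comp R Num.sqrt (fun u => u ^+ 2 + e) t _ _
            (is_derive1_sqrt q_gt0) dq).
by rewrite invfM mulrC mulrACA divff ?pnatr_eq0// mul1r.
Qed.

Lemma elem_fun_derive (R : realType) (e : R) (F : R -> R) : 0 < e -> elem_fun e F ->
  exists2 F', elem_fun e F' & forall t : R, is_derive t 1 F (F' t).
Proof.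
move=> e_gt0; elim=> {F} [a||||F G _ [F' eF' dF] _ [G' eG' dG]|
                         F G eF [F' eF' dF] eG [G' eG' dG]].
- by exists (cst 0) => [|t]; [exact: elem_cst|exact: is_derive_cst].
- by exists (cst 1) => [|t]; [exact: elem_cst|exact: is_derive_id].
- exists (id \* (fun t => (Num.sqrt (t ^+ 2 + e))^-1)) => [|t].
    by apply: elem_mul; [exact: elem_id|exact: elem_sqrtV].
  exact: is_derive_sqrt_sqr_add.
- pose s t := (Num.sqrt (t ^+ 2 + e))^-1.
  exists (cst (-1) \* (s \* (s \* (id \* s)))) => [|t].
    by do 4?apply: elem_mul; [exact: elem_cst|exact: elem_sqrtV..|
                              exact: elem_id|exact: elem_sqrtV].
  have r_neq0 : Num.sqrt (t ^+ 2 + e) != 0 by rewrite gt_eqF// sqrtr_gt0 sqr_add_gt0.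
  apply: is_derive_eq.
    exact: (@is_deriveV R _ t _ 1 r_neq0 (is_derive_sqrt_sqr_add t e_gt0)).
  by rewrite /s /= mulN1r [LHS]mulNr expr2 invfM -mulrA.
- exists (F' \+ G') => [|t]; first exact: elem_add.
  by apply: is_deriveD.
- exists ((F \* G') \+ (G \* F')) => [|t].
    by apply: elem_add; exact: elem_mul.
  by apply: is_deriveM.
Qed.

Lemma elem_fun_horner (R : realType) (e : R) (p : {poly R}) :
  elem_fun e (horner p).
Proof.
elim/poly_ind: p => [|p c IH].
  rewrite (_ : horner 0 = cst 0); first exact: elem_cst.
  by apply/funext => t; rewrite horner0.
rewrite (_ : horner _ = (horner p \* id) \+ cst c).
  by apply: elem_add; [apply: elem_mul; [|exact: elem_id]|exact: elem_cst].
by apply/funext => t; rewrite !hornerE.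
Qed.

Definition lform (R : realType) (d : nat) (L : 'cV[R]_d) (x : 'rV[R]_d) : R :=
  (x *m L) ord0 ord0.

Lemma lform_is_linear (R : realType) (d : nat) (L : 'cV[R]_d) :
  linear (lform L : 'rV[R]_d -> R^o).
Proof. by move=> a x y; rewrite /lform mulmxDl -scalemxAl !mxE. Qed.

HB.instance Definition _ (R : realType) (d : nat) (L : 'cV[R]_d) :=
  GRing.isLinear.Build R 'rV[R]_d R^o *:%R (lform L) (lform_is_linear L).

Lemma lform_differentiable (R : realType) (d : nat) (L : 'cV[R]_d) (x : 'rV[R]_d) :
  differentiable (lform L) x.
Proof.
rewrite (_ : lform L =
  \sum_(j < d) (fun y : 'rV[R]_d => (y ord0 j : R) *: (L j ord0 : R^o))).
  apply: differentiable_sum => j.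
  by apply: (@differentiableZl R _ R^o); exact: differentiable_coord.
by apply/funext => y; rewrite /lform mxE fct_sumE.
Qed.

Lemma lform_continuous (R : realType) (d : nat) (L : 'cV[R]_d) :
  continuous (lform L).
Proof. by move=> x; apply/differentiable_continuous/lform_differentiable. Qed.

Lemma lform_diff (R : realType) (d : nat) (L : 'cV[R]_d) (x : 'rV[R]_d) :
  'd (lform L) x = lform L :> ('rV[R]_d -> R).
Proof. exact: (@diff_lin R 'rV[R]_d R^o (lform L) x (@lform_continuous R d L)). Qed.

Lemma differentiable_ridge (R : realType) (d : nat) (L : 'cV[R]_d) (w x : 'rV[R]_d)
    (F : R -> R) (a : R) :
  is_derive (lform L x) 1 F a ->
  differentiable (fun y => F (lform L y) *: w) x.
Proof.
move=> [dF _]; apply: differentiableZl.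
apply: (@differentiable_comp R _ _ _ (lform L) F).
  exact: lform_differentiable.
exact/derivable1_diffP.
Qed.

Lemma derive_ridge (R : realType) (d : nat) (L : 'cV[R]_d) (w v x : 'rV[R]_d)
    (F : R -> R) (a : R) :
  is_derive (lform L x) 1 F a ->
  'D_v (fun y => F (lform L y) *: w) x = (lform L v * a) *: w.
Proof.
move=> dF; rewrite deriveE; last exact: differentiable_ridge dF.
have [/derivable1_diffP dF1 dFa] := dF.
have dl := lform_differentiable L x.
rewrite (@diffZl R _ _ (F \o lform L) w x); last exact: differentiable_comp.
by rewrite diff_comp//= diff1E// lform_diff derive1E dFa.
Qed.

(** A directional derivative of a ridge map is again a ridge map, with the same
    form [L] and direction [w], and with a profile in the same class. *)
Lemma class_C_ridge (R : realType) (d : nat) (L : 'cV[R]_d) (w : 'rV[R]_d) (e : R)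
    (F : R -> R) (k : nat) :
  0 < e -> elem_fun e F -> class_C k (fun x => F (lform L x) *: w).
Proof.
move=> e_gt0; elim: k F => [|k IH] F /(elem_fun_derive e_gt0)[F' eF' dF].
  by move=> x; apply: differentiable_continuous; exact: differentiable_ridge (dF _).
split=> [x|v]; first exact: differentiable_ridge (dF _).
rewrite (_ : (fun x => _) = fun x => (cst (lform L v) \* F') (lform L x) *: w).
  by apply: IH; apply: elem_mul eF'; exact: elem_cst.
by apply/funext => x; rewrite (derive_ridge _ _ (dF _)).
Qed.

Lemma class_C_cst (R : realType) (d : nat) (a : 'rV[R]_d) (k : nat) :
  class_C k (cst a : 'rV[R]_d -> 'rV[R]_d).
Proof.
elim: k a => [|k IH] a; first exact: cst_continuous.
split=> [x|v]; first exact: differentiable_cst.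
rewrite (_ : (fun x => _) = cst 0); first exact: IH.
by apply/funext => x; rewrite derive_cst.
Qed.

Lemma class_C_id (R : realType) (d : nat) (k : nat) :
  class_C k (id : 'rV[R]_d -> 'rV[R]_d).
Proof.
case: k => [|k]; first by move=> x; exact: cvg_id.
split=> [x|v]; first exact: ex_diff.
rewrite (_ : (fun x => _) = cst v); first exact: class_C_cst.
by apply/funext => x; rewrite derive_id.
Qed.

Lemma class_C_add (R : realType) (d : nat) (f g : 'rV[R]_d -> 'rV[R]_d) (k : nat) :
  class_C k f -> class_C k g -> class_C k (fun x => f x + g x).
Proof.
elim: k f g => [|k IH] f g /=; first by move=> cf cg x; exact: continuousD (cf x) (cg x).
move=> [df Cf] [dg Cg]; split=> [x|v]; first exact: differentiableD.
rewrite (_ : (fun x => _) = fun x => 'D_v f x + 'D_v g x); first exact: IH.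
by apply/funext => x; rewrite deriveD//; exact: diff_derivable.
Qed.

Lemma class_C_sum (R : realType) (d n : nat) (f : 'I_n -> 'rV[R]_d -> 'rV[R]_d)
    (k : nat) :
  (forall i, class_C k (f i)) -> class_C k (fun x => \sum_i f i x).
Proof.
elim: n f => [|n IH] f Cf.
  rewrite (_ : (fun x => _) = cst 0); first exact: class_C_cst.
  by apply/funext => x; rewrite big_ord0.
rewrite (_ : (fun x => _) = fun x => f ord0 x + \sum_i f (lift ord0 i) x).
  by apply: class_C_add => //; exact: IH.
by apply/funext => x; rewrite big_ord_recl.
Qed.

Lemma smooth_differentiable (R : realType) (d : nat) (g : 'rV[R]_d -> 'rV[R]_d) x :
  smooth g -> differentiable g x.
Proof. by move=> /(_ 1%N)[]. Qed.

(** * Shears and transitivity in dimension at least 2 *)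

(** When [A] squares to 0, [1 + A] is the square of the invertible matrix
    [1 + A / 2], so that its determinant is a nonzero square. *)
Lemma det_add1_sqr0_gt0 (R : realFieldType) (d : nat) (A : 'M[R]_d) :
  A *m A = 0 -> 0 < \det (1%:M + A).
Proof.
move=> AA0; set B := 1%:M + 2^-1 *: A.
have half2 : 2^-1 *: A + 2^-1 *: A = A
  by rewrite -scalerDl (_ : 2^-1 + 2^-1 = 1) ?scale1r//; lra.
have BB : B *m B = 1%:M + A.
  rewrite mulmxDl !mulmxDr !mul1mx mulmx1 -scalemxAl -scalemxAr AA0 !scaler0 addr0.
  by rewrite -addrA half2.
have BC : B *m (1%:M - 2^-1 *: A) = 1%:M.
  rewrite mulmxDl !mulmxBr !mul1mx mulmx1 -scalemxAl -scalemxAr AA0 !scaler0 subr0.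
  by rewrite subrK.
rewrite -BB det_mulmx lt_def sqr_ge0 mulf_eq0 orbb andbT.
apply: contraPneq (congr1 determinant BC) => B0.
by rewrite det_mulmx B0 mul0r det1 => /esym/eqP; rewrite oner_eq0.
Qed.

Definition shear (R : realType) (d n : nat) (L : 'cV[R]_d) (p : 'I_n -> {poly R})
    (w : 'I_n -> 'rV[R]_d) (x : 'rV[R]_d) : 'rV[R]_d :=
  x + \sum_i (p i).[lform L x] *: w i.

Lemma shear_smooth (R : realType) (d n : nat) (L : 'cV[R]_d) (p : 'I_n -> {poly R})
    (w : 'I_n -> 'rV[R]_d) :
  smooth (shear L p w).
Proof.
move=> k; apply: class_C_add; first exact: class_C_id.
apply: class_C_sum => i; apply: (class_C_ridge L (w i) k (ltr01 : (0 : R) < 1)).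
exact: elem_fun_horner.
Qed.

Lemma lform_shear (R : realType) (d n : nat) (L : 'cV[R]_d) (p : 'I_n -> {poly R})
    (w : 'I_n -> 'rV[R]_d) (x : 'rV[R]_d) :
  (forall i, lform L (w i) = 0) -> lform L (shear L p w x) = lform L x.
Proof.
move=> Lw; rewrite /shear linearD linear_sum big1 ?addr0// => i _.
by rewrite linearZ /= Lw scaler0.
Qed.

(** A shear preserves [L], so the displacement of [x] can be read off its image. *)
Lemma shearNK (R : realType) (d n : nat) (L : 'cV[R]_d) (p : 'I_n -> {poly R})
    (w : 'I_n -> 'rV[R]_d) :
  (forall i, lform L (w i) = 0) ->
  cancel (shear L p w) (shear L p (fun i => - w i)).
Proof.
move=> Lw x; rewrite {1}/shear lform_shear// /shear -addrA -big_split big1 ?addr0//=.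
by move=> i _; rewrite scalerN subrr.
Qed.

(** The Jacobian is [1 + L *m P], where the velocity [P] of the displacement is a
    combination of the [w i], hence is killed by [L]; thus [L *m P] squares to 0. *)
Lemma shear_Diff0 (R : realType) (d n : nat) (L : 'cV[R]_d) (p : 'I_n -> {poly R})
    (w : 'I_n -> 'rV[R]_d) :
  (forall i, lform L (w i) = 0) -> Diff0 R d (shear L p w).
Proof.
move=> Lw; split.
  split; first exact: shear_smooth.
  exists (shear L p (fun i => - w i)); split; [exact: shear_smooth|exact: shearNK|].
  have NwK : (fun i => - - w i) = w by apply/funext => i; rewrite opprK.
  rewrite -[X in cancel _ (shear _ _ X)]NwK.
  by apply: shearNK => i; rewrite linearN /= Lw oppr0.
move=> x; set P := \sum_i (p i)^`().[lform L x] *: w i.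
have PL : P *m L = 0.
  apply/matrixP => i j; rewrite !ord1 -[LHS]/(lform L P) linear_sum big1 ?mxE// => k _.
  by rewrite linearZ /= Lw scaler0.
have -> : jacobian (shear L p w) x = 1%:M + L *m P.
  apply/row_matrixP => i; rewrite !rowE; move: (delta_mx _ _) => v.
  rewrite -deriveEjacobian; last exact/smooth_differentiable/shear_smooth.
  have dpi k : is_derive (lform L x) 1 (horner (p k)) (p k)^`().[lform L x].
    exact: is_derive_poly.
  have -> : shear L p w = id + \sum_i (fun y : 'rV[R]_d => (p i).[lform L y] *: w i).
    by apply/funext => y; rewrite /shear fctE fct_sumE.
  have dridge k : derivable (fun y : 'rV[R]_d => (p k).[lform L y] *: w k) x v.
    by apply: diff_derivable; exact: differentiable_ridge (dpi k).
  rewrite deriveD; last by apply: derivable_sum.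
    rewrite derive_id derive_sum// mulmxDr mulmx1; congr (_ + _).
    rewrite mulmxA [v *m L]mx11_scalar mul_scalar_mx scaler_sumr.
    by apply: eq_bigr => k _; rewrite (derive_ridge _ _ (dpi k)) scalerA.
  exact: derivable_id.
by apply: det_add1_sqr0_gt0; rewrite mulmxA -(mulmxA L) PL mulmx0 mul0mx.
Qed.

Lemma lagrange_basis (K : fieldType) (N : nat) (s : 'I_N -> K) : injective s ->
  exists p : 'I_N -> {poly K}, forall i j, (p i).[s j] = (i == j)%:R.
Proof.
move=> s_inj.
exists (fun i => \prod_(k | k != i) ((s i - s k)^-1 *: ('X - (s k)%:P))) => i j.
rewrite horner_prod; have [<-|ij] := eqVneq i j.
  rewrite big1// => k ki; rewrite hornerZ hornerXsubC mulVf// subr_eq0.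
  by rewrite (inj_eq s_inj) eq_sym.
by rewrite (bigD1 j) 1?eq_sym//= hornerZ hornerXsubC subrr mulr0 mul0r.
Qed.

Lemma shear_interpolation (R : realType) (d N : nat) (L : 'cV[R]_d)
    (x y : 'I_N -> 'rV[R]_d) :
  injective (fun i => lform L (x i)) ->
  (forall i, lform L (y i) = lform L (x i)) ->
  exists2 g, Diff0 R d g & forall i, g (x i) = y i.
Proof.
move=> Lx_inj Lyx; have [p pP] := lagrange_basis Lx_inj.
exists (shear L p (fun i => y i - x i)) => [|i].
  by apply: shear_Diff0 => i; rewrite linearB /= Lyx subrr.
rewrite /shear (bigD1 i)//= pP eqxx scale1r big1 ?addr0 1?addrC ?subrK// => j ji.
by rewrite pP (negbTE ji) scale0r.
Qed.

Lemma nonroot_exists (K : numDomainType) (p : {poly K}) : p != 0 ->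
  exists t, ~~ root p t.
Proof.
move=> p_neq0; apply: contrapT => /forallNP all_root.
have := @max_poly_roots K p [seq k%:R | k <- iota 0 (size p)] p_neq0.
rewrite size_map size_iota ltnn => bound; apply: notF; apply: bound.
  by apply/allP => t _; apply/negPn/negP; exact: all_root.
by rewrite map_inj_uniq ?iota_uniq//; exact: mulrIn (oner_neq0 K).
Qed.

(** The point of parameter [t] on the moment curve, seen as a linear form: the form
    then evaluates at [t] the polynomial whose coefficients are the coordinates,
    and any finite set is separated for generic [t]. *)
Definition moment_col (R : realType) (d : nat) (t : R) : 'cV[R]_d := \col_j t ^+ j.

Lemma lform_moment_col (R : realType) (d : nat) (t : R) (x : 'rV[R]_d) :
  lform (moment_col d t) x = (rVpoly x).[t].
Proof.
rewrite /lform mxE horner_poly; apply: eq_bigr => j _.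
by rewrite valK mxE.
Qed.

(** The differences of distinct points are finitely many nonzero polynomials;
    any [t] that is a root of none of them works. *)
Lemma moment_col_separates (R : realType) (d N : nat) (x y : 'I_N -> 'rV[R]_d) :
  injective x -> injective y ->
  exists t, injective (fun i => lform (moment_col d t) (x i)) /\
            injective (fun i => lform (moment_col d t) (y i)).
Proof.
move=> x_inj y_inj.
(* This polynomial in [t] vanishes exactly when two of the points get the same value. *)
pose gaps (z : 'I_N -> 'rV[R]_d) :=
  \prod_(ij : 'I_N * 'I_N | ij.1 != ij.2) rVpoly (z ij.1 - z ij.2).
have gaps_neq0 z : injective z -> gaps z != 0.
  move=> z_inj; apply/prodf_neq0 => -[i j] /= ij.
  apply/eqP => /(congr1 (@poly_rV R d)); rewrite rVpolyK linear0 => /eqP.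
  by rewrite subr_eq0 (inj_eq z_inj) (negbTE ij).
have sep z t : ~~ root (gaps z) t -> injective (fun i => lform (moment_col d t) (z i)).
  rewrite /root horner_prod => /prodf_neq0 gap i j zij.
  apply/eqP/negPn/negP => ij; have := gap (i, j) ij.
  by rewrite -lform_moment_col linearB /= zij subrr eqxx.
have [t] := nonroot_exists (mulf_neq0 (gaps_neq0 x x_inj) (gaps_neq0 y y_inj)).
rewrite rootM negb_or => /andP[xt yt].
by exists t; split; exact: sep.
Qed.

(** Let [l] separate both configurations, let [m] be a coordinate other than the
    first, and let [u], [w] be the basis dual to [l], [m] in a plane.  A shear
    that preserves [l] makes the values of [m] distinct; a shear that preserves
    [m] then gives [l] its final values; a last shear that preserves [l] moves each
    point to its destination within its level set of [l]. *)
Lemma Diff0_transitive (R : realType) (d N : nat) (x z : 'I_N -> 'rV[R]_d.+2) :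
  injective x -> injective z ->
  exists g1 g2 g3, [/\ Diff0 R d.+2 g1, Diff0 R d.+2 g2, Diff0 R d.+2 g3 &
    forall i, g3 (g2 (g1 (x i))) = z i].
Proof.
move=> x_inj z_inj; have [t [lx_inj lz_inj]] := moment_col_separates x_inj z_inj.
set l := moment_col d.+2 t in lx_inj lz_inj.
pose j1 : 'I_d.+2 := lift ord0 ord0.
pose m : 'cV[R]_d.+2 := delta_mx j1 ord0.
pose u : 'rV[R]_d.+2 := delta_mx ord0 ord0.
pose w : 'rV[R]_d.+2 := delta_mx ord0 j1 - t *: u.
have l_delta j : lform l (delta_mx ord0 j) = t ^+ j.
  by rewrite /lform -rowE !mxE.
have m_delta j : lform m (delta_mx ord0 j) = (j == j1)%:R.
  by rewrite /lform -rowE !mxE eqxx andbT.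
have lu : lform l u = 1 by rewrite l_delta.
have mu : lform m u = 0 by rewrite m_delta.
have lw : lform l w = 0.
  by rewrite linearB linearZ /= lu l_delta /= expr1 scaler1 subrr.
have mw : lform m w = 1.
  by rewrite linearB linearZ /= mu m_delta eqxx scaler0 subr0.
pose x1 i := x i + (i%:R - lform m (x i)) *: w.
pose x2 i := x1 i + (lform l (z i) - lform l (x i)) *: u.
have lx1 i : lform l (x1 i) = lform l (x i).
  by rewrite linearD linearZ /= lw scaler0 addr0.
have mx1 i : lform m (x1 i) = i%:R.
  by rewrite linearD linearZ /= mw scaler1 addrC subrK.
have lx2 i : lform l (x2 i) = lform l (z i).
  by rewrite linearD linearZ /= lu scaler1 lx1 addrC subrK.
have mx2 i : lform m (x2 i) = lform m (x1 i).
  by rewrite linearD linearZ /= mu scaler0 addr0.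
have [g1 Dg1 g1E] := shear_interpolation lx_inj lx1.
have mx1_inj : injective (fun i => lform m (x1 i)).
  move=> i j /=; rewrite !mx1 => /eqP; rewrite eqr_nat => /eqP; exact: val_inj.
have [g2 Dg2 g2E] := shear_interpolation mx1_inj mx2.
have lx2_inj : injective (fun i => lform l (x2 i)).
  by move=> i j /=; rewrite !lx2; exact: lz_inj.
have [g3 Dg3 g3E] := shear_interpolation lx2_inj (fun i => esym (lx2 i)).
by exists g1, g2, g3; split=> // i; rewrite g1E g2E g3E.
Qed.

(** * Kinks and transitivity on the line *)

(** A real function, seen as a self-map of the space of row vectors of length 1
    and written as a ridge map so that [class_C_ridge] applies. *)
Definition on_line (R : realType) (F : R -> R) (x : 'rV[R]_1) : 'rV[R]_1 :=
  F (lform 1%:M x) *: 1%:M.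

Lemma lform1E (R : realType) (x : 'rV[R]_1) : lform 1%:M x = x ord0 ord0.
Proof. by rewrite /lform mulmx1. Qed.

Lemma on_lineE (R : realType) (F : R -> R) (x : 'rV[R]_1) :
  on_line F x ord0 ord0 = F (x ord0 ord0).
Proof. by rewrite /on_line lform1E !mxE mulr1. Qed.

Lemma rV1_eq (R : realType) (x y : 'rV[R]_1) : x ord0 ord0 = y ord0 ord0 -> x = y.
Proof. by move=> xy; apply/rowP => i; rewrite !ord1. Qed.

Lemma on_line_comp (R : realType) (F G : R -> R) :
  on_line (F \o G) = on_line F \o on_line G.
Proof. by apply/funext => x; apply: rV1_eq; rewrite /= !on_lineE. Qed.

Lemma on_lineK (R : realType) (F G : R -> R) :
  cancel F G -> cancel (on_line F) (on_line G).
Proof. by move=> FK x; apply: rV1_eq; rewrite !on_lineE FK. Qed.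

Lemma on_line_continuous (R : realType) (F : R -> R) :
  continuous F -> continuous (on_line F).
Proof.
move=> cF x; apply: (@continuous_comp _ _ _ (F \o lform 1%:M) ( *:%R^~ 1%:M)).
  by apply: continuous_comp; [exact: lform_continuous|exact: cF].
exact: scalel_continuous.
Qed.

Lemma on_line_Diff0 (R : realType) (e e' : R) (F G : R -> R) :
  0 < e -> 0 < e' -> elem_fun e F -> elem_fun e' G -> cancel F G -> cancel G F ->
  (forall t a : R, is_derive t 1 F a -> 0 < a) -> Diff0 R 1 (on_line F).
Proof.
move=> e_gt0 e'_gt0 eF eG FK GK F'_gt0.
have F_smooth : smooth (on_line F) by move=> k; exact: class_C_ridge eF.
split=> [|x].
  split=> //; exists (on_line G); split; [|exact: on_lineK..].
  by move=> k; exact: class_C_ridge eG.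
have [F' _ dF] := elem_fun_derive e_gt0 eF.
rewrite det_mx11 -[jacobian _ _]mul1mx -deriveEjacobian.
  rewrite (derive_ridge _ _ (dF _)) lform1E !mxE mul1r mulr1.
  exact: F'_gt0 (dF _).
exact: smooth_differentiable.
Qed.

Lemma translation_Diff0 (R : realType) (c : R) :
  Diff0 R 1 (on_line (fun t => t + c)).
Proof.
have elem_translation b : elem_fun 1 (fun t : R => t + b).
  by apply: elem_add; [exact: elem_id|exact: elem_cst].
apply: (on_line_Diff0 ltr01 ltr01 (elem_translation c) (elem_translation (- c))).
- exact: addrK.
- exact: subrK.
- move=> t a [_ <-]; rewrite deriveD// derive_id derive_cst addr0.
  exact: ltr01.
Qed.

(** A branch of a hyperbola, with asymptotes of slopes [a + b] and [a - b]. *)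
Definition hyperbola (R : realType) (a b e t : R) : R :=
  a * t + b * Num.sqrt (t ^+ 2 + e).

(** Along the branch, this quantity is [sqrt (t ^+ 2 + e)] times the slope; its
    square also appears under the root when the branch is inverted. *)
Lemma hyperbola_conj_gt0 (R : realType) (a b e t : R) : `|b| < a -> 0 < e ->
  0 < a * Num.sqrt (t ^+ 2 + e) + b * t.
Proof.
move=> ba e_gt0; set r := Num.sqrt _.
have r_gt0 : 0 < r by rewrite sqrtr_gt0 sqr_add_gt0.
have tr : `|t| <= r by rewrite -sqrtr_sqr ler_wsqrtr// lerDl ltW.
have : - (b * t) <= `|b| * r.
  apply: le_trans (ler_norm _) _; rewrite normrN normrM.
  by rewrite ler_wpM2l.
have : `|b| * r < a * r by rewrite ltr_pM2r.
lra.
Qed.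

(** Exchanging the coordinates maps a hyperbola to a hyperbola.  The formula for
    the inverse solves the quadratic equation
    [(y - a * t) ^+ 2 = b ^+ 2 * (t ^+ 2 + e)] in [t]. *)
Lemma hyperbolaK (R : realType) (a b e : R) : `|b| < a -> 0 < e ->
  let D := a ^+ 2 - b ^+ 2 in
  cancel (hyperbola a b e) (hyperbola (a / D) (- (b / D)) (D * e)).
Proof.
move=> ba e_gt0 D t; rewrite /hyperbola; set r := Num.sqrt (t ^+ 2 + e).
have rr : r ^+ 2 = t ^+ 2 + e by rewrite sqr_sqrtr// ltW// sqr_add_gt0.
have D_neq0 : D != 0.
  rewrite /D subr_sqr mulf_neq0// gt_eqF//; move: ba; rewrite ltr_norml; lra.
(* The discriminant is a square, so its root is rational in [t] and [r]. *)
have -> : (a * t + b * r) ^+ 2 + D * e = (a * r + b * t) ^+ 2.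
  by have -> : e = r ^+ 2 - t ^+ 2 by [rewrite rr; ring]; rewrite /D; ring.
rewrite sqrtr_sqr ger0_norm; last exact/ltW/hyperbola_conj_gt0.
by rewrite /D; field.
Qed.

Lemma hyperbola_Diff0 (R : realType) (a b e : R) : `|b| < a -> 0 < e ->
  Diff0 R 1 (on_line (hyperbola a b e)).
Proof.
move=> ba e_gt0; pose D := a ^+ 2 - b ^+ 2.
have D_gt0 : 0 < D.
  rewrite /D subr_sqr mulr_gt0//; move: ba; rewrite ltr_norml; lra.
have elem_hyperbola a' b' e' : elem_fun e' (hyperbola a' b' e' : R -> R).
  by apply: elem_add; apply: elem_mul;
    [exact: elem_cst|exact: elem_id|exact: elem_cst|exact: elem_sqrt].
apply: (on_line_Diff0 e_gt0 (mulr_gt0 D_gt0 e_gt0) (elem_hyperbola _ _ _)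
  (elem_hyperbola (a / D) (- (b / D)) _)); first exact: hyperbolaK.
  (* The conjugate parameters of the conjugate parameters are the original ones. *)
  set a' := a / D; set b' := - (b / D).
  have ba' : `|b'| < a'.
    rewrite /b' normrN normrM (gtr0_norm (_ : 0 < D^-1)) ?invr_gt0//.
    by rewrite ltr_pM2r ?invr_gt0.
  have := hyperbolaK ba' (mulr_gt0 D_gt0 e_gt0); rewrite /=.
  have D_neq0 := lt0r_neq0 D_gt0.
  have -> : a' ^+ 2 - b' ^+ 2 = D^-1 by rewrite /a' /b' /D; field.
  by rewrite /a' /b' !invrK mulNr opprK !divfK// mulKf.
move=> t s [_ <-]; set r := Num.sqrt (t ^+ 2 + e).
have r_gt0 : 0 < r by rewrite sqrtr_gt0 sqr_add_gt0.
have dr := is_derive_sqrt_sqr_add t e_gt0.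
have dh : is_derive t 1 (hyperbola a b e) (a *: 1 + b *: (t / r)).
  exact: (is_deriveD (is_deriveZ a (is_derive_id t 1)) (is_deriveZ b dr)).
rewrite (@derive_val _ _ _ _ _ _ _ dh).
have -> : a *: 1 + b *: (t / r) = (a * r + b * t) / r.
  by rewrite [a *: 1]mulr1 mulrDl mulfK ?gt_eqF// -mulrA.
by rewrite divr_gt0// hyperbola_conj_gt0.
Qed.

(** The piecewise linear map of slope 1 on the left of 0 and [s] on the right:
    the limit of [hyperbola ((1 + s) / 2) ((s - 1) / 2) e] as [e] tends to 0. *)
Definition kink (R : realType) (s t : R) : R :=
  (1 + s) / 2 * t + (s - 1) / 2 * `|t|.

Lemma kink_npos (R : realType) (s t : R) : t <= 0 -> kink s t = t.
Proof. by move=> t_le0; rewrite /kink ler0_norm//; lra. Qed.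

Lemma kink_nneg (R : realType) (s t : R) : 0 <= t -> kink s t = s * t.
Proof. by move=> t_ge0; rewrite /kink ger0_norm//; lra. Qed.

Lemma kink_increasing (R : realType) (s t u : R) : 0 < s -> t < u -> kink s t < kink s u.
Proof.
move=> s_gt0 tu; have [t_le0|t_gt0] := leP t 0; have [u_le0|u_gt0] := leP u 0.
- by rewrite !kink_npos.
- by rewrite kink_npos// kink_nneg ?ltW//; apply: le_lt_trans t_le0 _; rewrite mulr_gt0.
- lra.
- by rewrite !kink_nneg ?ltW// ltr_pM2l.
Qed.

Lemma kink_continuous (R : realType) (s : R) : continuous (kink s).
Proof.
move=> t; apply: continuousD; apply: continuousM.
- exact: cst_continuous.
- exact: cvg_id.
- exact: cst_continuous.
- exact: norm_continuous.
Qed.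

(** The distance from the kink to the hyperbola with [e = eta ^+ 2] is at most
    [`|b| * eta], because [`|t| <= sqrt (t ^+ 2 + eta ^+ 2) <= `|t| + eta]. *)
Lemma kink_approximable (R : realType) (H : set ('rV[R]_1 -> 'rV[R]_1)) (s : R) :
  C_UAP H (Diff0 R 1) -> 0 < s -> approximable H (on_line (kink s)).
Proof.
move=> UAP s_gt0; apply: approximable_closed.
  by apply: on_line_continuous; exact: kink_continuous.
move=> N x eps eps_gt0; set a := (1 + s) / 2; set b := (s - 1) / 2.
have ba : `|b| < a by rewrite ltr_norml /a /b; lra.
pose eta := eps / (`|b| + 1).
have b1_gt0 : 0 < `|b| + 1 by rewrite ltr_wpDl.
have eta_gt0 : 0 < eta by rewrite divr_gt0.
have eta2_gt0 : 0 < eta ^+ 2 by rewrite exprn_gt0.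
exists (on_line (hyperbola a b (eta ^+ 2))) => [|i].
  by apply: approximable_Diff0 => //; exact: hyperbola_Diff0.
rewrite rV1_norm !mxE mulr1; set t := lform _ _.
rewrite mulr1 /kink /hyperbola -/a -/b.
have -> : a * t + b * `|t| - (a * t + b * Num.sqrt (t ^+ 2 + eta ^+ 2)) =
          - (b * (Num.sqrt (t ^+ 2 + eta ^+ 2) - `|t|)) by ring.
have lower : `|t| <= Num.sqrt (t ^+ 2 + eta ^+ 2).
  by rewrite -sqrtr_sqr ler_wsqrtr// lerDl ltW.
have upper : Num.sqrt (t ^+ 2 + eta ^+ 2) <= `|t| + eta.
  rewrite -[leRHS]ger0_norm; last by rewrite addr_ge0// ltW.
  rewrite -sqrtr_sqr ler_wsqrtr// sqrrD real_normK ?num_real// lerD2r lerDl.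
  by rewrite mulrn_wge0// mulr_ge0// ltW.
rewrite normrN normrM (ger0_norm (_ : 0 <= _ - _)) ?subr_ge0//.
apply: (@le_trans _ _ (`|b| * eta)); first by rewrite ler_wpM2l// lerBlDl.
by rewrite /eta mulrCA ger_pMr// ler_pdivrMr// mul1r lerDl.
Qed.

(** The points are put into place from left to right.  A kink at the last point in
    place fixes everything on its left, and its slope is chosen so as to
    move the next point to its target. *)
Lemma approximable_transitive_line (R : realType) (H : set ('rV[R]_1 -> 'rV[R]_1))
    (N : nat) (x z : 'I_N -> 'rV[R]_1) :
  (forall g h, H g -> H h -> H (g \o h)) -> C_UAP H (Diff0 R 1) ->
  admissible x -> admissible z ->
  exists2 T, approximable H T & forall i, T (x i) = z i.
Proof.
move=> H_comp UAP [_ /(_ erefl) x_incr] [_ /(_ erefl) z_incr].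
have approx_translation c : approximable H (on_line (fun t : R => t + c)).
  by apply: approximable_Diff0 => //; exact: translation_Diff0.
have approx_comp F G : approximable H (on_line F) -> approximable H (on_line G) ->
    approximable H (on_line (F \o G)).
  by rewrite on_line_comp; exact: approximable_comp.
pose X i := x i ord0 ord0; pose Z i := z i ord0 ord0.
have step n : (n <= N)%N -> exists F : R -> R,
    [/\ approximable H (on_line F), {homo F : t u / t < u} &
        forall i : 'I_N, (i < n)%N -> F (X i) = Z i].
  elim: n => [|n IH] nN.
    by exists (fun t => t + 0); split=> // t u; rewrite ltrD2r.
  have [F [aF F_incr FX]] := IH (ltnW nN).
  pose k := Ordinal nN.
  case: n => [|m] in nN IH FX k *.
    (* Nothing is in place yet: translate the first point to its target. *)
    pose c := Z k - F (X k).
    exists ((fun t => t + c) \o F); split.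
    - exact: approx_comp.
    - by move=> t u tu; rewrite /= ltrD2r F_incr.
    - move=> i; rewrite ltnS leqn0 => /eqP i0.
      by have -> : i = k by [apply: val_inj]; rewrite /= /c addrC subrK.
  (* [c] is the last target already attained, where the kink is placed. *)
  pose j := Ordinal (ltnW nN); pose c := Z j.
  have Fj : F (X j) = c by apply: FX.
  have c_lt_F : c < F (X k) by rewrite -Fj; apply/F_incr/x_incr.
  have c_lt_Z : c < Z k by apply: z_incr.
  pose s := (Z k - c) / (F (X k) - c).
  have s_gt0 : 0 < s by rewrite divr_gt0// subr_gt0.
  exists ((fun t => t + c) \o (kink s \o ((fun t => t - c) \o F))); split.
  - apply: (approx_comp _ _ (approx_translation c)); apply: (approx_comp (kink s)).
      exact: kink_approximable.
    exact: (approx_comp _ _ (approx_translation (- c))).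
  - by move=> t u tu; rewrite /= ltrD2r kink_increasing// ltrD2r F_incr.
  - move=> i; rewrite ltnS leq_eqVlt => /predU1P[im|im] /=.
      have -> : i = k by apply: val_inj.
      rewrite kink_nneg; last by rewrite subr_ge0 ltW.
      by rewrite divfK ?subrK// subr_eq0 gt_eqF.
    rewrite kink_npos ?subrK ?FX// subr_le0.
    move: im; rewrite ltnS leq_eqVlt => /predU1P[im|im].
      by rewrite /c (_ : i = j)//; exact: val_inj.
    by apply/ltW/z_incr.
have [F [aF _ FX]] := step N (leqnn N).
by exists (on_line F) => // i; apply: rV1_eq; rewrite on_lineE; exact: FX.
Qed.

(** * Universal interpolation *)

Theorem theorem2p11 (R : realType) (d : nat) (d_gt0 : (0 < d)%N)
    (F : set ('rV[R]_d -> 'rV[R]_d))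
    (F_lipschitz : forall f, F f -> lipschitz f)
    (F_symmetric : symmetric_family F)
    (F_UAP : C_UAP (flow_compositions F) (Diff0 R d))
    (F_local_UIP : local_UIP (flow_compositions F)) :
  UIP (flow_compositions F).
Proof.
apply: UIP_of_approximable_transitivity => // N x z x_adm z_adm.
have F_comp g h := @flow_compositions_comp R d F g h.
case: d => [//|[|d]] in d_gt0 F F_lipschitz F_symmetric F_UAP F_local_UIP
  x z x_adm z_adm F_comp *.
  exact: approximable_transitive_line.
have [g1 [g2 [g3 [Dg1 Dg2 Dg3 gE]]]] := Diff0_transitive (proj1 x_adm) (proj1 z_adm).
exists (g3 \o (g2 \o g1)) => //.
have approx_Diff0 g := @approximable_Diff0 R d.+2 _ g F_UAP.
apply: (approximable_comp F_comp (approx_Diff0 g3 Dg3)).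
exact: (approximable_comp F_comp (approx_Diff0 g2 Dg2) (approx_Diff0 g1 Dg1)).
Qed.
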